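(* Let $\Omega_e=[x_{e-1/2},x_{e+1/2}]$ be a one-dimensional element of length $h$, with polynomial DG solution $U_e$ on $\Omega_e$ and exterior trace values $U_{e-1}(x_{e-1/2})$, $U_{e+1}(x_{e+1/2})$ from the neighbouring elements. Let $$\overline{U}_e^{\Delta t}=\overline{U}_e-\frac{\Delta t}{h}\Big(\widehat F\big(U_e(x_{e-1/2}),U_{e-1}(x_{e-1/2}),-1\big)+\widehat F\big(U_e(x_{e+1/2}),U_{e+1}(x_{e+1/2}),1\big)\Big)$$ be the element average after one forward Euler step of size $\Delta t>0$, where $\widehat F$ is the local Lax--Friedrichs flux with dissipation coefficient $\lambda$ satisfying $$\lambda\ge\max\{\nu(U)\;:\;U\in\{U_{e-1}(x_{e-1/2}),\,U_e(x_{e-1/2}),\,U_e(x_{e+1/2}),\,U_{e+1}(x_{e+1/2})\}\}.$$ Let $\theta_l,\theta_r>0$ be such that $\theta_q:=w_q-\theta_l\phi_q(x_{e-1/2})-\theta_r\phi_q(x_{e+1/2})\ge 0$ for all $q=1,\dots,N_q$. If $$\frac{\Delta t\,\lambda}{h}\le\frac12\min\{\theta_l,\theta_r\},$$ then $$s(\overline{U}_e^{\Delta t})\ \ge\ s_e^0(t):=\min\{s(U(y))\;:\;y\in\Omega_e\cup\partial\Omega_e^-\}.$$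
   Context: One-dimensional Euler equations: states $U=(\rho,\rho u,\rho e)^T\in\mathbb{R}^3$, flux $F(U)=(\rho u,\rho u^2+p,u(\rho e+p))^T$, pressure $p=(\gamma-1)(\rho e-\tfrac12\rho u^2)$ with constant ratio of specific heats $\gamma=1.4$. Sound speed $c=\sqrt{\gamma p/\rho}$, maximum characteristic speed $\nu(U)=|u|+c$, entropy $s(U)=\ln p-\gamma\ln\rho+s_0$ with a fixed constant $s_0$ (defined for states with $\rho>0$, $p>0$). All values of the solution at time $t$ appearing here, i.e. $U_e(x)$ for $x\in\Omega_e$ and the exterior traces, have $\rho>0$ and $p>0$. Local Lax--Friedrichs flux in direction $\hat n\in\{-1,1\}$ with dissipation coefficient $\lambda$: $\widehat F(U_L,U_R,\hat n)=\tfrac12(F(U_L)+F(U_R))\hat n-\tfrac12\lambda(U_R-U_L)$. $U_e$ belongs (componentwise) to an $N_p$-dimensional polynomial space $V_e$ on $\Omega_e$. The points $x_1,\dots,x_{N_q}\in\Omega_e$ with positive weights $w_1,\dots,w_{N_q}$, $\sum_q w_q=1$, $N_q\ge N_p$, form a quadrature rule exact on $V_e$, so that the element average is $\overline U_e=\frac1h\int_{\Omega_e}U_e\,dx=\sum_q w_qU_e(x_q)$. The functions $\phi_q$ are Lagrange interpolation basis functions of $V_e$ at $N_p$ points chosen among the quadrature points (chosen so that the interpolation matrix $[\varphi_m(x_q)]$ of a basis $\{\varphi_m\}$ of $V_e$ at those points is non-singular), with $\phi_q\equiv 0$ for quadrature points not chosen; thus $P(x)=\sum_{q=1}^{N_q}P(x_q)\phi_q(x)$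 for all $P\in V_e$, $x\in\Omega_e$. $\partial\Omega_e^-$ denotes the exterior side of the element boundary: the values $U(y)$ for $y\in\partial\Omega_e^-$ are $U_{e-1}(x_{e-1/2})$ and $U_{e+1}(x_{e+1/2})$, while $U(y)=U_e(y)$ for $y\in\Omega_e$.
   Formalization: The polynomial space V_e is assumed to contain the constants, as the DG update of the element average requires; for a polynomial space without constants the claim as written can fail. *)

(* Defs.v *)
From HB Require Import structures.
From mathcomp Require Import all_boot all_order all_algebra.
From mathcomp Require Import all_classical all_reals all_analysis.

Set Implicit Arguments.
Unset Strict Implicit.
Unset Printing Implicit Defensive.

Import Order.TTheory GRing.Theory Num.Theory.
Import numFieldNormedType.Exports.

Local Open Scope classical_set_scope.
Local Open Scope ring_scope.

Section Euler.
Context {R : realType}.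

(* Conservative variables U = (rho, rho u, rho e)^T. *)
Definition state := 'cV[R]_3.

Definition mk_state (a b c : R) : state := \col_i [tuple a; b; c]`_i.

Definition density (U : state) : R := U (inord 0) 0.
Definition momentum (U : state) : R := U (inord 1) 0.
Definition energy (U : state) : R := U (inord 2) 0.

Definition gamma : R := 14 / 10.

Definition velocity (U : state) : R := momentum U / density U.

Definition pressure (U : state) : R :=
  (gamma - 1) * (energy U - 2^-1 * density U * velocity U ^+ 2).

Definition flux (U : state) : state :=
  mk_state (momentum U)
           (density U * velocity U ^+ 2 + pressure U)
           (velocity U * (energy U + pressure U)).

Definition sound_speed (U : state) : R :=
  Num.sqrt (gamma * pressure U / density U).

Definition char_speed (U : state) : R := `|velocity U| + sound_speed U.

(* [ln] and division are total, so [entropy], [velocity] and [sound_speed]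
   carry their intended meaning only at admissible states. *)
Definition admissible (U : state) : Prop := 0 < density U /\ 0 < pressure U.

Definition entropy (s0 : R) (U : state) : R :=
  ln (pressure U) - gamma * ln (density U) + s0.

(* The direction [n] ranges over {-1, 1}. *)
Definition llf_flux (lambda : R) (UL UR : state) (n : R) : state :=
  (n / 2) *: (flux UL + flux UR) - (lambda / 2) *: (UR - UL).

Definition average (xl xr : R) (f : R -> R) : R :=
  (xr - xl)^-1 * \int[lebesgue_measure]_(x in `[xl, xr]) f x.

(* A DG solution on an element: three polynomial components. *)
Definition dg_eval d (U : 'I_3 -> {poly_d R}) (x : R) : state :=
  \col_i (U i : {poly R}).[x].

Definition dg_average (xl xr : R) d (U : 'I_3 -> {poly_d R}) : state :=
  \col_i average xl xr (fun x => (U i : {poly R}).[x]).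

(* Average on [xl, xr] after one forward Euler step; [Um] and [Up] are the
   exterior traces at [xl] and [xr]. *)
Definition updated_average (xl xr dt lambda : R) d (U : 'I_3 -> {poly_d R})
    (Um Up : state) : state :=
  dg_average xl xr U -
    (dt / (xr - xl)) *: (llf_flux lambda (dg_eval U xl) Um (-1) +
                         llf_flux lambda (dg_eval U xr) Up 1).

(* A DG space on an element is a subspace [V] of the polynomials of degree
   less than [d], for some [d], which contains the constants: the evolution
   equation of the element average is the weak form tested with 1. *)
Definition contains_constants d (V : {vspace {poly_d R}}) : Prop :=
  exists2 P : {poly_d R}, P \in V & (P : {poly R}) = 1.

Record quadrature_exact_on d (V : {vspace {poly_d R}}) (xl xr : R)
    (Nq : nat) (x w : 'I_Nq -> R) : Prop := {
  quad_point : forall q, x q \in `[xl, xr];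
  quad_weight_gt0 : forall q, 0 < w q;
  quad_weight_sum : \sum_q w q = 1;
  quad_exact : forall P : {poly_d R}, P \in V ->
    average xl xr (fun y => (P : {poly R}).[y]) =
    \sum_q w q * (P : {poly R}).[x q] }.

(* [sigma] selects the interpolation points among the quadrature points, and
   [phi] is the associated Lagrange basis of [V] padded with zeros. *)
Record lagrange_at_quadrature d (V : {vspace {poly_d R}}) (Nq : nat)
    (x : 'I_Nq -> R) (sigma : 'I_(\dim V) -> 'I_Nq)
    (phi : 'I_Nq -> {poly_d R}) : Prop := {
  lagrange_inj : injective sigma;
  lagrange_unisolvent :
    \matrix_(j, m) ((vbasis V)`_m : {poly R}).[x (sigma j)] \in unitmx;
  lagrange_mem : forall q, phi q \in V;
  lagrange_delta : forall j k,
    (phi (sigma j) : {poly R}).[x (sigma k)] = (j == k)%:R;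
  lagrange_unchosen : forall q, q \notin codom sigma -> phi q = 0 }.

Definition is_minimum (A : set R) (m : R) : Prop := A m /\ lbound A m.

(* Entropy values over the element together with the exterior side of its
   boundary. *)
Definition entropy_values (s0 xl xr : R) d (U : 'I_3 -> {poly_d R})
    (Um Up : state) : set R :=
  [set entropy s0 (dg_eval U y) | y in `[xl, xr]] `|`
  [set entropy s0 Um; entropy s0 Up].

End Euler.

(* Main.v *)
(* The states with [rho > 0] and [p >= K rho^gamma] form a convex set cut out by
   half-spaces: for all [t >= 0] and [us], the affine functional
   [D(U) = E - us m + (us^2/2 - 7/2 K t^2) rho + K t^7], tangent to its boundary
   at density [t^5] and velocity [us], is nonnegative.  With [L] the linear part
   of [D], put [D_F(U) = L(F(U)) + us K t^7].  The new average is a combination,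
   with weights [theta_q], of the values at the quadrature points, plus a
   boundary part in which the terms [us K t^7] of the two faces cancel.  By the
   CFL condition the boundary part belongs to the cone over the set as soon as
   [lambda D(X) +- D_F(X) + lambda D(Y) >= 0] for all [X] and [Y] in the set of
   characteristic speed at most [lambda], at least when [|us| <= lambda]; this
   is enough since the boundary part has velocity at most [lambda].  The part
   [lambda D(X) +- D_F(X)] alone can be negative, because shocks may be faster
   than [|u| + c] on both sides.  The surplus [lambda D(Y)], with [Y] a trace of
   [U_e], compensates for it and comes from the factor 1/2 in the CFL condition.
   As [gamma = 7/5], taking seventh roots of pressures as variables turns these
   inequalities into polynomial ones. *)
Require Import Defs.
From HB Require Import structures.
From mathcomp Require Import all_boot all_order all_algebra.
From mathcomp Require Import all_classical all_reals all_analysis.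
From mathcomp Require Import ring lra.

Set Implicit Arguments.
Unset Strict Implicit.
Unset Printing Implicit Defensive.

Import Order.TTheory GRing.Theory Num.Theory.
Import numFieldNormedType.Exports.

Local Open Scope classical_set_scope.
Local Open Scope ring_scope.

(* Proves a polynomial inequality of degree at most [n] on an interval on which
   the affine functions [a] and [b], vanishing at its two ends, are nonnegative:
   it succeeds when the coefficients in the Bernstein basis [a^i b^(n-i)] are
   nonnegative. *)
Ltac bernstein_terms n i a b :=
  lazymatch i with
  | 0%N => have := mulr_ge0 (exprn_ge0 0 a) (exprn_ge0 n b)
  | S ?j => have := mulr_ge0 (exprn_ge0 i a) (exprn_ge0 (n - i)%N b);
            bernstein_terms n j a b
  end.

Ltac bernstein n a b :=
  let m := eval compute in n in bernstein_terms m m a b; rewrite /=; clear; lra.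

(** * Polynomial inequalities in scaled variables *)

Section Poly.
Context {R : realFieldType}.
Implicit Types x z w d v r : R.

(* [D(U)] in units of [rho* c*^2], where the star denotes the reference state of
   density [t^5], pressure [K t^7] and velocity [us]: here [r = rho/rho*],
   [w = (us - u)/c*] and [y = p/p*].  The lemmas take [y = z^7]; then
   [p >= K rho^gamma] is [r <= z^5]. *)
Definition gap r w y : R := 1/2 * r * w ^+ 2 + 25/14 * y - 5/2 * r + 5/7.

(* The gap at [r = z^5], [w = 0], [y = z^7]. *)
Definition rest_gap z : R := 5/14 * (5 * z ^+ 7 - 7 * z ^+ 5 + 2).

Definition rest_cofactor z : R :=
  5/14 * (2 + 4 * z + 6 * z ^+ 2 + 8 * z ^+ 3 + 10 * z ^+ 4 + 5 * z ^+ 5).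

(** The half-space touches the set at the reference state, hence the double zero at [z = 1]. *)
Lemma rest_gapE z : rest_gap z = (1 - z) ^+ 2 * rest_cofactor z.
Proof. rewrite /rest_gap /rest_cofactor; lra. Qed.

Lemma rest_cofactor_ge0 z : 0 <= z -> 0 <= rest_cofactor z.
Proof.
move=> z0; rewrite /rest_cofactor; apply: mulr_ge0; first lra.
by rewrite !addr_ge0 // mulr_ge0 ?exprn_ge0.
Qed.

Lemma rest_gap_ge0 z : 0 <= z -> 0 <= rest_gap z.
Proof.
by move=> z0; rewrite rest_gapE mulr_ge0 ?sqr_ge0 ?rest_cofactor_ge0.
Qed.

(** Up to a factor, this is [2 z^7 rest_gap z >= 25/49 (z^7 - 1)^2], for [pressure_work_le_gap]. The
    zero at [z = 1] is triple and the Taylor coefficients there are nonnegative. *)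
Lemma strong_shock_poly_ge0 z : 1 <= z ->
    0 <= 30 * z ^+ 14 - 49 * z ^+ 12 + 24 * z ^+ 7 - 5.
Proof.
move=> z1; pose x := z - 1; have x0 : 0 <= x by rewrite /x; lra.
have -> : z = 1 + x by rewrite /x; ring.
have X n : 0 <= x ^+ n by rewrite exprn_ge0.
move: (X 3) (X 4) (X 5) (X 6) (X 7) (X 8) (X 9) (X 10) (X 11) (X 12) (X 13)
  (X 14).
by clear; lra.
Qed.

Lemma cubic_tangent w l : 0 <= w -> 0 <= l ->
    3 * l ^+ 2 * w - 2 * l ^+ 3 <= w ^+ 3.
Proof.
move=> w0 l0.
have : 0 <= (w - l) ^+ 2 * (w + 2 * l) by rewrite mulr_ge0 ?sqr_ge0//; lra.
lra.
Qed.

(* In this lemma and the next, [199/100 - 17/10 z] and [212/100 - 167/100 z]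
   exceed the minimizers over [w >= 0] of [w^3 + w^2/2 - 5 (1 - z^2) w] and of
   [w^3 - 5 (1 - z^2) w], and are close to them where the bounds are tight. *)
Lemma cubic_minimum_le_rest_gap z : 0 <= z -> z <= 4/5 ->
  z^+5 * (2 * (199/100 - 17/10 * z)^+3 + 1/2 * (199/100 - 17/10 * z)^+2) <=
    rest_gap z.
Proof.
move=> z0 z1; rewrite /rest_gap.
have a : 0 <= 5 * z by lra.
have b : 0 <= 4 - 5 * z by lra.
bernstein 8%N a b.
Qed.

Lemma cubic_minimum_le z : 0 <= z -> z <= 1 ->
    z ^+ 5 * (2 * (212/100 - 167/100 * z) ^+ 3) <= 2/5.
Proof.
move=> z0 z1; have b : 0 <= 1 - z by lra.
bernstein 14%N z0 b.
Qed.

(** * Lower bounds for [lambda D(X) - D_F(X)] at pressures below the reference *)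

Definition slack z w : R :=
  1/2 * z ^+ 5 * (w ^+ 3 + w ^+ 2 - 5 * (1 - z ^+ 2) * w) + rest_gap z.
Definition isentropic_gap z w : R := 1/2 * z ^+ 5 * w ^+ 2 + rest_gap z.

(** The right side is the scaled [lambda D(X) - D_F(X)] at a state with [p = K rho^gamma] when
    [us + c*] equals [lambda], so that [lambda - u] becomes [w + 1]. *)
Lemma slackE z w : slack z w =
    (w + 1) * isentropic_gap z w - 5/7 * (1 - z ^+ 7) * w.
Proof. rewrite /slack /isentropic_gap /rest_gap; lra. Qed.

Lemma isentropic_gap_ge0 z w : 0 <= z -> 0 <= isentropic_gap z w.
Proof.
move=> z0; rewrite /isentropic_gap addr_ge0 ?rest_gap_ge0// mulr_ge0 ?sqr_ge0//.
by rewrite mulr_ge0 ?exprn_ge0//; lra.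
Qed.

(** Twice the slack minus the gap is [z^5] times a cubic, convex for [w >= 0], plus [rest_gap z].
    The tangent line at [l] bounds the cubic from below and, its slope being nonnegative, is least
    at [w = 0]. *)
Lemma isentropic_gap_le_slack z w : 0 <= z -> z <= 4/5 -> 0 <= w ->
    isentropic_gap z w <= 2 * slack z w.
Proof.
move=> z0 z1 w0.
pose l := 199/100 - 17/10 * z; have l0 : 0 <= l by rewrite /l; lra.
have tw := cubic_tangent w0 l0.
have sl : 0 <= (w - l) ^+ 2 by rewrite sqr_ge0.
have lA : 0 <= (3 * l ^+ 2 + l - 5 * (1 - z ^+ 2)) * w.
  rewrite mulr_ge0//; rewrite /l.
  (* The slope is a quadratic in [z] with vertex near [805/1000]. *)
  have := sqr_ge0 (z - 805/1000); lra.
have z5 : 0 <= z ^+ 5 by rewrite exprn_ge0.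
have : 0 <= z ^+ 5 * (w ^+ 3 + 1/2 * w ^+ 2 - 5 * (1 - z ^+ 2) * w
    + 2 * l ^+ 3 + 1/2 * l ^+ 2) by apply: mulr_ge0 => //; lra.
have := cubic_minimum_le_rest_gap z0 z1; rewrite -/l /slack /isentropic_gap;
  lra.
Qed.

Lemma slack_sub_gap_ge z w : 0 <= z -> z <= 1 -> 0 <= w ->
  - (1/5) <= slack z w - isentropic_gap z w.
Proof.
move=> z0 z1 w0.
pose l := 212/100 - 167/100 * z; have l0 : 0 <= l by rewrite /l; lra.
have tw := cubic_tangent w0 l0.
have lA : 0 <= (3 * l ^+ 2 - 5 * (1 - z ^+ 2)) * w.
  rewrite mulr_ge0//; rewrite /l.
  have := sqr_ge0 (z - 795/1000); lra.
have z5 : 0 <= z ^+ 5 by rewrite exprn_ge0.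
have : 0 <= z ^+ 5 * (w ^+ 3 - 5 * (1 - z ^+ 2) * w + 2 * l ^+ 3)
  by apply: mulr_ge0 => //; lra.
have := cubic_minimum_le z0 z1; rewrite -/l /slack /isentropic_gap; lra.
Qed.

(** Times [(1 - z)^3], this is the minimum over [w] of [slack z w] without its cubic term in [w],
    attained at [w = 5/2 (1 - z^2)]. *)
Definition slack_rest z : R := 5/7 + 15/7 * z + 30/7 * z ^+ 2 + 50/7 * z ^+ 3 +
  75/7 * z ^+ 4 + 75/8 * z ^+ 5 + 25/8 * z ^+ 6.

Lemma slack_restE z : (1 - z) ^+ 3 * slack_rest z =
  rest_gap z - 25/8 * z ^+ 5 * (1 - z) ^+ 2 * (1 + z) ^+ 2.
Proof. rewrite /slack_rest /rest_gap; lra. Qed.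

(** [rest_cofactor] is convex, and the right side is a line barely above its chord. *)
Lemma rest_cofactor_le z : 4/5 <= z -> z <= 1 ->
    rest_cofactor z <= 25/2 - 287/10 * (1 - z).
Proof.
move=> z0 z1; rewrite /rest_cofactor.
have a : 0 <= 5 * z - 4 by lra.
have b : 0 <= 1 - z by lra.
bernstein 5%N a b.
Qed.

Lemma slack_rest_ge z : 4/5 <= z -> z <= 1 ->
  (5/4 + 1634/1000 * z ^+ 5) * ((1 - z) * (25/2 - 287/10 * (1 - z)) ^+ 2) <=
    slack_rest z.
Proof.
move=> z0 z1; rewrite /slack_rest.
have a : 0 <= 5 * z - 4 by lra.
have b : 0 <= 1 - z by lra.
bernstein 8%N a b.
Qed.

Lemma rest_gap_le z : 4/5 <= z -> z <= 1 -> rest_gap z <= 27/100.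
Proof.
move=> z0 z1; rewrite /rest_gap.
have a : 0 <= 5 * z - 4 by lra.
have b : 0 <= 1 - z by lra.
bernstein 7%N a b.
Qed.

Lemma sqr_isentropic_gap_le_slack z w : 4/5 <= z -> z <= 1 -> 0 <= w ->
    isentropic_gap z w <= 2/5 ->
  5/4 * isentropic_gap z w ^+ 2 <= slack z w.
Proof.
move=> z0 z1 w0 D25.
have z00 : 0 <= z by lra.
have q0 := rest_gap_ge0 z00; have q27 := rest_gap_le z0 z1.
have z5 : 0 <= z ^+ 5 by rewrite exprn_ge0.
have z51 : z ^+ 5 <= 1 by rewrite exprn_ile1.
have b : 0 <= 1 - z by lra.
set q := rest_gap z in q0 q27.
have sq : 0 <= z ^+ 5 * (w - 5/2 * (1 - z) * (1 + z)) ^+ 2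
  by rewrite mulr_ge0 ?sqr_ge0.
(* Using [cub] costs [121/20 z^5 q^3], which [q <= 27/100] turns into at most
   [1634/1000 z^5 q^2]. *)
have Rq : (5/4 + 1634/1000 * z ^+ 5) * q ^+ 2 <= (1 - z) ^+ 3 * slack_rest z.
  rewrite /q rest_gapE.
  have z01 : 0 <= z by lra.
  have q20 : 0 <= rest_cofactor z by exact: rest_cofactor_ge0.
  have : rest_cofactor z ^+ 2 <= (25/2 - 287/10 * (1 - z)) ^+ 2.
    by rewrite ler_pXn2r ?nnegrE ?rest_cofactor_le//; clear -z0; lra.
  move=> /(ler_wpM2l (exprn_ge0 4 b)) => q4.
  have e0 : 0 <= 5/4 + 1634/1000 * z ^+ 5 by lra.
  have := ler_wpM2l (exprn_ge0 3 b) (slack_rest_ge z0 z1).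
  have := ler_wpM2l e0 q4.
  clear; lra.
(* This bounds [(z^5 w^2)^2], from the square of the gap, by a multiple of [z^5 w^3]. *)
have wz : z ^+ 5 * w <= 9/10.
  rewrite -(@ler_pXn2r _ 2) ?nnegrE ?mulr_ge0 ?divr_ge0//.
  have : z ^+ 5 * (z ^+ 5 * w ^+ 2) <= 1 * (4/5).
    apply: ler_pM => //; first by rewrite mulr_ge0 ?sqr_ge0.
    by move: D25; rewrite /isentropic_gap -/q; lra.
  lra.
have T0 : 0 <= z ^+ 5 * w ^+ 2 by rewrite mulr_ge0 ?sqr_ge0.
have Tw : 0 <= (z ^+ 5 * w ^+ 2) * w * (9/10 - z ^+ 5 * w).
  by rewrite mulr_ge0 ?mulr_ge0//; lra.
have cub : 0 <= z ^+ 5 * (7/16 * w ^+ 3 - 5/2 * q * w ^+ 2 + 121/10 * q ^+ 3).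
  apply: mulr_ge0 => //.
  (* [80/21 q] minimizes [7/16 w^3 - 5/2 q w^2] over [w >= 0]. *)
  have c0 : 0 <= 80/21 * q by lra.
  have : 0 <= (w - 80/21 * q) ^+ 2 * (w + 40/21 * q).
    by rewrite mulr_ge0 ?sqr_ge0//; lra.
  have : 0 <= q ^+ 3 by rewrite exprn_ge0.
  lra.
have q3 : z ^+ 5 * q ^+ 2 * q <= z ^+ 5 * q ^+ 2 * (27/100).
  by apply: ler_wpM2l => //; rewrite mulr_ge0 ?sqr_ge0.
have z5q : 0 <= z ^+ 5 * q ^+ 2 by rewrite mulr_ge0 ?sqr_ge0.
have Tw0 : 0 <= z ^+ 5 * w ^+ 2 * w by rewrite mulr_ge0.
move: (slack_restE z) Rq; rewrite /slack /isentropic_gap -/q => ->.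
move: sq Tw cub q3 z5q Tw0; clear; lra.
Qed.

(** Here [d] is the scaled excess of [us + c*] over [lambda]. With [D] the gap, the slack is at
    least [5/4 D^2] for [D <= 2/5], and at least [D - 1/5], the tangent line of this parabola at
    [2/5], beyond. The minimum of [5/4 D^2 - d D] is [-1/5 d^2]. *)
Lemma isentropic_gap_step_ge z w d : 0 <= z -> z <= 1 -> 0 <= w -> 0 <= d ->
    d <= 1 ->
  - (1/5 * d ^+ 2) <= (w + (1 - d)) * isentropic_gap z w -
    5/7 * (1 - z ^+ 7) * w.
Proof.
move=> z0 z1 w0 d0 d1.
have -> : (w + (1 - d)) * isentropic_gap z w - 5/7 * (1 - z ^+ 7) * w =
  slack z w - d * isentropic_gap z w.
  by rewrite slackE; ring.
have D0 := isentropic_gap_ge0 w z0.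
have [D25|D25] := lerP (isentropic_gap z w) (2/5).
  have : 5/4 * isentropic_gap z w ^+ 2 <= slack z w.
    have [z8|/ltW z8] := lerP z (4/5); last exact: sqr_isentropic_gap_le_slack.
    have := isentropic_gap_le_slack z0 z8 w0.
    have := mulr_ge0 D0 (_ : 0 <= 2/5 - isentropic_gap z w); lra.
  have := sqr_ge0 (isentropic_gap z w - 2/5 * d); lra.
have := slack_sub_gap_ge z0 z1 w0.
have d1' : 0 <= 1 - d by lra.
have := mulr_ge0 d1' (_ : 0 <= isentropic_gap z w - 2/5).
have := sqr_ge0 (1 - d); lra.
Qed.

Lemma gap_isentropic z w : gap (z ^+ 5) w (z ^+ 7) = isentropic_gap z w.
Proof. rewrite /gap /isentropic_gap /rest_gap; lra. Qed.

Lemma affine_ge0_between (a b r s : R) : 0 <= r -> r <= s -> 0 <= b ->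
    0 <= a * s + b ->
  0 <= a * r + b.
Proof.
move=> r0 rs b0 ab.
have [a0|/ltW a0] := lerP 0 a; first by rewrite addr_ge0 ?mulr_ge0.
have := ler_wnM2l a0 rs; lra.
Qed.

(** The expression is affine in [r], so the ends [r = 0] and [r = z^5] suffice. *)
Lemma gap_step_ge z w d r : 0 <= z -> z <= 1 -> 0 <= w -> 0 <= d -> d <= 1 ->
  0 <= r -> r <= z ^+ 5 ->
  - (1/5 * d ^+ 2) <= (w + (1 - d)) * gap r w (z ^+ 7) - 5/7 * (1 - z ^+ 7) * w.
Proof.
move=> z0 z1 w0 d0 d1 r0 rz.
have z7 : 0 <= z ^+ 7 by rewrite exprn_ge0.
rewrite -subr_ge0.
have -> : (w + (1 - d)) * gap r w (z ^+ 7) - 5/7 * (1 - z ^+ 7) * w -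
    - (1/5 * d ^+ 2)
  = ((w + (1 - d)) * (1/2 * w ^+ 2 - 5/2)) * r +
    ((w + (1 - d)) * gap 0 w (z ^+ 7) - 5/7 * (1 - z ^+ 7) * w + 1/5 * d ^+ 2).
  by rewrite /gap; lra.
apply: affine_ge0_between rz _ _ => //.
  have w1 := mulr_ge0 w0 z7.
  have w2 : 0 <= (1 - d) * (25/14 * z ^+ 7 + 5/7) by apply: mulr_ge0; lra.
  have := sqr_ge0 d; rewrite /gap; move: w1 w2; clear; lra.
have := isentropic_gap_step_ge z0 z1 w0 d0 d1; rewrite -gap_isentropic /gap;
  lra.
Qed.

(** * Lower bounds for the compensating gap [D(Y)] *)

Lemma rest_gap_sub_sqr_ge z : 0 <= z -> z <= 9/10 ->
    1/20 <= rest_gap z - 2/7 * (1 - z) ^+ 2.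
Proof.
move=> z0 z1; rewrite /rest_gap.
have a : 0 <= 10 * z by lra.
have b : 0 <= 9 - 10 * z by lra.
bernstein 7%N a b.
Qed.

Lemma boundary_gap_ge z : 0 <= z -> z <= 9/10 ->
    1/100 <= 1/2 * z ^+ 7 + rest_gap z - 2/7.
Proof.
move=> z0 z1; rewrite /rest_gap.
have a : 0 <= 10 * z by lra.
have b : 0 <= 9 - 10 * z by lra.
bernstein 12%N a b.
Qed.

(** The bound on [w] is what [u' + c' <= lambda] gives at a trace: too slow or too cold for a
    reference exceeding [lambda] by [d], it keeps a gap of order [d^2]. *)
Lemma sqr_le_isentropic_gap z d w : 0 <= z -> 0 <= d -> d <= 1 ->
    z - (1 - d) <= w ->
  2/7 * d ^+ 2 <= isentropic_gap z w.
Proof.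
move=> z0 d0 d1 dw; rewrite /isentropic_gap.
have q0 := rest_gap_ge0 z0.
have z5 : 0 <= z ^+ 5 by rewrite exprn_ge0.
have w2 : 0 <= z ^+ 5 * w ^+ 2 by rewrite mulr_ge0 ?sqr_ge0.
have [z1|/ltW z1] := lerP 1 z.
  have w0 : d <= w by lra.
  have : d ^+ 2 <= w ^+ 2 by rewrite ler_pXn2r ?nnegrE//; lra.
  have : 1 * w ^+ 2 <= z ^+ 5 * w ^+ 2 by rewrite ler_wpM2r ?sqr_ge0//
    exprn_ege1.
  have := sqr_ge0 d; lra.
have q2_ge : 5/7 <= rest_cofactor z.
  rewrite /rest_cofactor; have := exprn_ge0 2 z0; have := exprn_ge0 3 z0.
  by have := exprn_ge0 4 z0; lra.
have Q : 5/7 * (1 - z) ^+ 2 <= rest_gap z.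
  by rewrite rest_gapE mulrC ler_wpM2l ?sqr_ge0.
have [dx|/ltW dx] := lerP d (1 - z).
  have : d ^+ 2 <= (1 - z) ^+ 2 by rewrite ler_pXn2r ?nnegrE//; lra.
  have := sqr_ge0 (1 - z); lra.
pose v := d - (1 - z); have v0 : 0 <= v by rewrite /v; lra.
have vz : 0 <= z - v by rewrite /v; lra.
have vw : z ^+ 5 * v ^+ 2 <= z ^+ 5 * w ^+ 2.
  by rewrite ler_wpM2l// ler_pXn2r ?nnegrE//; rewrite /v; lra.
have -> : d = (1 - z) + v by rewrite /v; lra.
suff : 2/7 * ((1 - z) + v) ^+ 2 <= 1/2 * (z ^+ 5 * v ^+ 2) + rest_gap z by lra.
have [z9|/ltW z9] := lerP z (9/10).
  have [z00|zn0] := eqVneq z 0.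
    have -> : v = 0 by lra.
    by rewrite z00 /rest_gap !expr0n /=; lra.
  have zp : 0 < z by rewrite lt_def zn0.
  rewrite -(ler_pM2l zp).
  have z59 : z ^+ 5 <= (9/10) ^+ 5 by rewrite ler_pXn2r ?nnegrE//; lra.
  (* The difference of the two sides is a quadratic in [v] with this leading coefficient, so it lies
     little below its chord from [v = 0] to [v = z]; the two preceding lemmas bound the end
     values. *)
  have c1 : 1/2 * z ^+ 5 - 2/7 <= 1/100 by lra.
  have vz0 : 0 <= v * (z - v) * z by rewrite !mulr_ge0.
  have vz1 : 0 <= (z - v) * (1 - v * z).
    rewrite mulr_ge0// subr_ge0 mulr_ile1//; lra.
  have := ler_wpM2l vz0 c1.
  have := ler_wpM2l vz (rest_gap_sub_sqr_ge z0 z9).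
  have := ler_wpM2l v0 (boundary_gap_ge z0 z9).
  move: vz1 vz0; clear -v0 vz; lra.
have z5_ge : (9/10) ^+ 5 <= z ^+ 5 by rewrite ler_pXn2r ?nnegrE//; lra.
have q2_ge' : 92/10 <= rest_cofactor z.
  have := q2_ge; rewrite /rest_cofactor; move: z5_ge.
  have : (9/10) ^+ 4 <= z ^+ 4 by rewrite ler_pXn2r ?nnegrE//; lra.
  have : (9/10) ^+ 3 <= z ^+ 3 by rewrite ler_pXn2r ?nnegrE//; lra.
  have : (9/10) ^+ 2 <= z ^+ 2 by rewrite ler_pXn2r ?nnegrE//; lra.
  move: z9; clear; lra.
have := ler_wpM2l (sqr_ge0 (1 - z)) q2_ge'; rewrite -rest_gapE.
have z5' : 29/100 + 1/200 <= 1/2 * z ^+ 5 by lra.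
have := ler_wpM2r (sqr_ge0 v) z5'.
have xv : 0 <= (1 - z) * v by rewrite mulr_ge0//; lra.
(* The remaining quadratic form is nearly degenerate, with its minimum in [v] near
   [308/10 (1 - z)]. *)
have := sqr_ge0 (v - 308/10 * (1 - z)); have := sqr_ge0 (1 - z);
  have := sqr_ge0 v.
move: xv; clear; lra.
Qed.

Lemma sqr_le_gap z d w r : 0 <= z -> 0 <= d -> d <= 1 -> z - (1 - d) <= w ->
  0 <= r -> r <= z ^+ 5 -> 2/7 * d ^+ 2 <= gap r w (z ^+ 7).
Proof.
move=> z0 d0 d1 dw r0 rz.
have z7 : 0 <= z ^+ 7 by rewrite exprn_ge0.
rewrite -subr_ge0.
have -> : gap r w (z ^+ 7) - 2/7 * d ^+ 2 =
  (1/2 * w ^+ 2 - 5/2) * r + (gap 0 w (z ^+ 7) - 2/7 * d ^+ 2).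
  by rewrite /gap; lra.
apply: affine_ge0_between rz _ _ => //.
  have d2 : d ^+ 2 <= 1 by rewrite expr_le1.
  by rewrite /gap; lra.
have := sqr_le_isentropic_gap z0 d0 d1 dw; rewrite -gap_isentropic /gap; lra.
Qed.

Lemma gap_ge0 z w r : 0 <= z -> 0 <= r -> r <= z ^+ 5 -> 0 <= gap r w (z ^+ 7).
Proof.
move=> z0 r0 rz.
have z7 : 0 <= z ^+ 7 by rewrite exprn_ge0.
have -> : gap r w (z ^+ 7) = (1/2 * w ^+ 2 - 5/2) * r + gap 0 w (z ^+ 7).
  by rewrite /gap; lra.
apply: affine_ge0_between rz _ _ => //; first by rewrite /gap; lra.
have := isentropic_gap_ge0 w z0; rewrite -gap_isentropic /gap; lra.
Qed.

(** At pressures above the reference no compensation is required: the work of the pressure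
    difference is at most [c] times the gap, and [c <= lambda - u]. *)
Lemma pressure_work_le_gap z c w r : 1 <= z -> 0 <= c -> r * c ^+ 2 = z ^+ 7 ->
  0 <= r -> r <= z ^+ 5 -> 5/7 * (z ^+ 7 - 1) * w <= c * gap r w (z ^+ 7).
Proof.
move=> z1 c0 rc r0 rz.
have [w0|/ltW w0] := lerP w 0.
  have z0 : 0 <= z by lra.
  apply: (@le_trans _ _ 0); last by rewrite mulr_ge0 ?gap_ge0.
  rewrite mulr_ge0_le0//; apply: mulr_ge0; first lra.
  by rewrite subr_ge0 exprn_ege1.
have z0 : 0 <= z by lra.
have z7 : 1 <= z ^+ 7 by rewrite exprn_ege1.
have q0 := rest_gap_ge0 z0.
rewrite -(@ler_pXn2r _ 2) ?nnegrE ?mulr_ge0 ?gap_ge0//; try lra.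
pose q := gap r 0 (z ^+ 7).
have -> : gap r w (z ^+ 7) = 1/2 * r * w ^+ 2 + q by rewrite /q /gap; lra.
have qq : rest_gap z <= q by rewrite /q /rest_gap /gap; lra.
have key : 25/49 * (z ^+ 7 - 1) ^+ 2 <= 2 * z ^+ 7 * rest_gap z.
  by have := strong_shock_poly_ge0 z1; rewrite /rest_gap; lra.
have key2 : 2 * z ^+ 7 * rest_gap z <= 2 * z ^+ 7 * q by rewrite ler_wpM2l//;
  lra.
(* AM-GM: [c (r w^2/2 + q) >= c |w| sqrt (2 r q)], and [r c^2 = z^7] *)
have k3 : (2 * z ^+ 7 * q) * w ^+ 2 <= (c * (1/2 * r * w ^+ 2 + q)) ^+ 2.
  rewrite -rc; have := sqr_ge0 (c * (1/2 * r * w ^+ 2 - q)); clear; lra.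
have k4 := ler_wpM2r (sqr_ge0 w) (le_trans key key2).
lra.
Qed.

(** * Compensation of the deficit at [X] by the gap at [Y] *)

Lemma density_sub_pressure_le z : 0 <= z -> z <= 7/10 ->
    z ^+ 5 - z ^+ 7 <= 87/1000.
Proof.
move=> z0 z1.
have a : 0 <= 10 * z by lra.
have b : 0 <= 7 - 10 * z by lra.
bernstein 7%N a b.
Qed.

Lemma rest_gap_ge z : 0 <= z -> z <= 7/10 -> 44/100 <= rest_gap z.
Proof.
move=> z0 z1; rewrite /rest_gap.
have a : 0 <= 10 * z by lra.
have b : 0 <= 7 - 10 * z by lra.
bernstein 7%N a b.
Qed.

(** The gap of the second state is spent only when [z < 1], [us > u] and [us + 1 > lam]. *)
Lemma gap_step_sum_ge0 lam us z c r u z' c' r' u' :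
  `|us| <= lam ->
  0 <= z -> 0 <= r -> r <= z ^+ 5 -> z <= c -> r * c ^+ 2 = z ^+ 7 ->
    `|u| + c <= lam ->
  0 <= z' -> 0 <= r' -> r' <= z' ^+ 5 -> z' <= c' -> `|u'| + c' <= lam ->
  0 <= (lam - u) * gap r (us - u) (z ^+ 7) - 5/7 * (1 - z ^+ 7) * (us - u)
       + lam * gap r' (us - u') (z' ^+ 7).
Proof.
move=> + z0 r0 rz zc rc + z0' r0' rz' zc'.
rewrite ler_norml => /andP[us1 us2] uc uc'.
have [u1 u2] : - u + c <= lam /\ u + c <= lam.
  by have := ler_norm u; have := ler_norm (- u); rewrite normrN; lra.
have [u1' u2'] : - u' + c' <= lam /\ u' + c' <= lam.
  by have := ler_norm u'; have := ler_norm (- u'); rewrite normrN; lra.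
have lam0 : 0 <= lam by lra.
have D0 := gap_ge0 (us - u) z0 r0 rz.
have D0' := gap_ge0 (us - u') z0' r0' rz'.
have lD := mulr_ge0 lam0 D0'.
have [z1|/ltW z1] := lerP 1 z.
  have c0 : 0 <= c by lra.
  have := pressure_work_le_gap (u - us) z1 c0 rc r0 rz.
  have -> : gap r (u - us) (z ^+ 7) = gap r (us - u) (z ^+ 7) by rewrite /gap;
    ring.
  have := ler_wpM2r D0 (_ : c <= lam - u); lra.
have z7 : 0 <= 1 - z ^+ 7 by rewrite subr_ge0 exprn_ile1.
set w := us - u in D0 *.
have [w0|/ltW w0] := lerP w 0.
  apply: addr_ge0 => //; rewrite subr_ge0.
  apply: (@le_trans _ _ 0); last by rewrite mulr_ge0//; lra.
  by rewrite mulr_ge0_le0// mulr_ge0//; lra.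
(* [1 - k] is the excess of [us + c*] over [lam], as [c* = 1] *)
pose k := lam - us; have k0 : 0 <= k by rewrite /k; lra.
have -> : lam - u = w + k by rewrite /w /k; ring.
have [k1|/ltW k1] := lerP 1 k.
  have := gap_step_ge z0 z1 w0 (lexx 0) ler01 r0 rz.
  have := ler_wpM2r D0 (_ : w + (1 - 0) <= w + k); lra.
(* The threshold makes the surplus [lam * 2/7 d^2] cover the deficit [1/5 d^2]. *)
have [l7|/ltW l7] := lerP (7/10) lam.
  have d0 : 0 <= 1 - k by lra.
  have d1 : 1 - k <= 1 by lra.
  have := gap_step_ge z0 z1 w0 d0 d1 r0 rz.
  have : z' - (1 - (1 - k)) <= us - u' by rewrite /k; lra.
  move=> /(sqr_le_gap z0' d0 d1)/(_ r0' rz') PP.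
  have := ler_wpM2l lam0 PP.
  have := ler_wpM2r (sqr_ge0 (1 - k)) l7.
  have -> : 1 - (1 - k) = k by ring.
  move: (sqr_ge0 (1 - k)); lra.
(* Now [z] and [z'] are small: the deficit is at most [5/2 * 87/1000 * w] with [w <= 2 lam], hence
   below the surplus [44/100 lam]. *)
have h1 := density_sub_pressure_le z0 (le_trans zc (_ : c <= 7/10)).
have h2 := rest_gap_ge z0' (le_trans zc' (_ : c' <= 7/10)).
have D'_ge : 44/100 <= gap r' (us - u') (z' ^+ 7).
  have := mulr_ge0 r0' (sqr_ge0 (us - u')).
  by move: h2; rewrite /rest_gap /gap; lra.
have kD := mulr_ge0 k0 D0.
have rw : 0 <= w * (r * w ^+ 2) by rewrite !mulr_ge0 ?sqr_ge0.
have wr := ler_wpM2l w0 rz.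
have w57 := ler_wpM2l w0 (h1 _).
have w2l : w <= 2 * lam by rewrite /w; lra.
have lD' := ler_wpM2l lam0 D'_ge.
have {}w57 : w * (z ^+ 5 - z ^+ 7) <= w * (87 / 1000) by apply: w57; lra.
move: kD rw wr w57 w2l lD'; rewrite /gap; clear -lam0; lra.
Qed.

End Poly.

(** * Lagrange interpolation and existence of the minimal entropy *)

Section Interp.
Context {R : realType}.

Definition npoly_eval d (y : R) (P : {poly_d R}) : R := (P : {poly R}).[y].

Lemma npoly_eval_linear d y : linear_for *%R (@npoly_eval d y).
Proof. by move=> a P Q; rewrite /npoly_eval /= hornerD hornerZ. Qed.
HB.instance Definition _ d y :=
  GRing.isLinear.Build R {poly_d R} R *%R (@npoly_eval d y)
    (@npoly_eval_linear d y).

(** The interpolation error vanishes at the chosen points, so the unisolvent matrix annihilates its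
    coordinates. *)
Lemma lagrange_interpolation d (V : {vspace {poly_d R}}) Nq (x : 'I_Nq -> R)
    sigma (phi : 'I_Nq -> {poly_d R}) (P : {poly_d R}) y :
  lagrange_at_quadrature (V := V) x sigma phi -> P \in V ->
  (P : {poly R}).[y] = \sum_q (P : {poly R}).[x q] * (phi q : {poly R}).[y].
Proof.
move=> [inj uni memV delta unch] PV.
pose I := \sum_j npoly_eval (x (sigma j)) P *: phi (sigma j).
have WV : P - I \in V by rewrite rpredB ?rpred_sum// => j _; rewrite rpredZ.
have W0 j : npoly_eval (x (sigma j)) (P - I) = 0.
  rewrite linearB linear_sum /= (bigD1 j)//= big1 ?addr0; last first.
    by move=> k kj; rewrite linearZ /= {2}/npoly_eval delta (negbTE kj) mulr0.
  by rewrite linearZ /= [X in _ * X]/npoly_eval delta eqxx mulr1 subrr.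
have P_I : P = I.
  apply/eqP; rewrite -subr_eq0; apply/eqP.
  rewrite (coord_vbasis WV) big1// => m _.
  pose c : 'cV[R]_(\dim V) := \col_m coord (vbasis V) m (P - I).
  suff c0 : c = 0 by move/colP/(_ m): c0; rewrite !mxE => ->; rewrite scale0r.
  rewrite -[c](mulKmx uni).
  set M := (X in invmx X *m (X *m c)).
  have -> : M *m c = 0; last by rewrite mulmx0.
  apply/colP => j; rewrite !mxE -[RHS](W0 j) [in RHS](coord_vbasis WV)
    linear_sum /=.
  by apply: eq_bigr => k _; rewrite linearZ /= !mxE mulrC.
rewrite -/(npoly_eval y P) {1}P_I linear_sum /=.
rewrite [RHS](bigID (mem (codom sigma)))/= [X in _ + X]big1 ?addr0; last first.
  by move=> q /unch ->; rewrite horner0 mulr0.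
transitivity (\sum_(q <- codom sigma) (P : {poly R}).[x q] *
    (phi q : {poly R}).[y]); last by rewrite big_uniq// map_inj_uniq ?enum_uniq.
rewrite big_image /=.
by apply: eq_bigr => j _; rewrite linearZ.
Qed.

Lemma entropy_min_exists s0 (xl xr : R) d (U : 'I_3 -> {poly_d R}) Um Up :
  xl < xr -> (forall y, y \in `[xl, xr] -> admissible (dg_eval U y)) ->
  exists m, is_minimum (entropy_values s0 xl xr U Um Up) m.
Proof.
move=> lr adm.
have [|y yI ymin] := @EVT_min R
  (fun y => entropy s0 (dg_eval U y)) xl xr (ltW lr).
  apply: continuous_in_subspaceT => t /[!inE] /= tI.
  have [d0 p0] := adm t tI.
  have cU i : {for t, continuous (fun y => dg_eval U y i 0)}.
    rewrite (_ : (fun y => _) = horner (U i)); first exact: continuous_horner.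
    by apply/funext => z; rewrite mxE.
  have cv : {for t, continuous (fun y => velocity (dg_eval U y))}.
    by apply: continuousM; [exact: cU|apply: cvgV;
      [rewrite gt_eqF//|exact: cU]].
  have cp : {for t, continuous (fun y => pressure (dg_eval U y))}.
    apply: continuousM; first exact: cst_continuous.
    apply: continuousB; first exact: cU.
    apply: continuousM; last exact: continuousM.
    by apply: continuousM; [exact: cst_continuous|exact: cU].
  rewrite /entropy; apply: (@cvgD R R^o); last exact: cst_continuous.
  apply: (@cvgB R R^o).
    by apply: continuous_comp; [exact: cp|exact: continuous_ln].
  apply: cvgM; first exact: cvg_cst.
  by apply: continuous_comp; [exact: cU|exact: continuous_ln].
pose m := Num.min (entropy s0 (dg_eval U y))
  (Num.min (entropy s0 Um) (entropy s0 Up)).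
exists m; split.
  rewrite /m /entropy_values /Num.min.
  case: ifP => _; first by left; exists y.
  by right => /=; case: ifP; [left|right].
move=> _ /= [[t tI <-]|[->|->]]; rewrite /m !ge_min ?lexx ?orbT// ymin//.
Qed.

End Interp.

(** * The convex set of states and its tangent functionals *)

Section States.
Context {R : realType}.
Implicit Types (U X Y : @state R) (K t us lam a e : R).

Lemma root_exists n (x : R) : 0 < x -> exists2 y, 0 < y & y ^+ n.+1 = x.
Proof.
move=> x0; exists (expR (ln x / n.+1%:R)); first exact: expR_gt0.
by rewrite -expRM_natr divfK ?pnatr_eq0// lnK.
Qed.

(* [p >= K rho^(7/5)], with the density given through its fifth root. *)
Definition in_cone K U :=
  exists2 s, 0 < s & density U = s ^+ 5 /\ K * s ^+ 7 <= pressure U.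

Lemma in_cone_density K U : in_cone K U -> 0 < density U.
Proof. by case=> s s0 [-> _]; rewrite exprn_gt0. Qed.

Lemma in_cone_entropy K U s0 : 0 < K -> in_cone K U ->
  admissible U /\ ln K + s0 <= entropy s0 U.
Proof.
move=> K0 [s sgt0 [rE pge]].
have s7 : 0 < s ^+ 7 by rewrite exprn_gt0.
have p0 : 0 < pressure U by apply: lt_le_trans pge; rewrite mulr_gt0.
split; first by split=> //; rewrite rE exprn_gt0.
have : ln (K * s ^+ 7) <= ln (pressure U) by rewrite ler_ln ?posrE//;
  exact: mulr_gt0.
rewrite /entropy rE; move: (pressure U) => p.
rewrite lnM ?posrE// (lnXn 7 sgt0) (lnXn 5 sgt0) -[ln s *+ 7]mulr_natl
  -[ln s *+ 5]mulr_natl /gamma.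
by move: (ln K) (ln s) (ln p) => lK ls lp; lra.
Qed.

Lemma entropy_in_cone U s0 m : admissible U -> m <= entropy s0 U ->
  in_cone (expR (m - s0)) U.
Proof.
move=> [r0 p0] mE; have [s sgt0 sE] := root_exists 4 r0.
exists s => //; split=> //.
rewrite -[s]lnK ?posrE// -expRM_natl -expRD -[leRHS]lnK ?posrE// ler_expR.
move: mE; rewrite /entropy -sE (lnXn 5 sgt0) -mulr_natl /gamma.
by move: (ln s) (ln (pressure U)) => ls lp; lra.
Qed.

(** This is [L]. The constant [K t^7] of [D] is kept apart so that linearity applies to sums of
    states and fluxes. *)
Definition tangent K t us U : R :=
  energy U - us * momentum U + (us ^+ 2 / 2 - 7/2 * K * t ^+ 2) * density U.

Lemma tangent_linear K t us : linear_for *%R (tangent K t us).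
Proof.
by move=> a X Y; rewrite /tangent /energy /momentum /density !mxE; ring.
Qed.
HB.instance Definition _ K t us :=
  GRing.isLinear.Build R _ R *%R (tangent K t us) (tangent_linear K t us).

Definition tangent_gap K t us rho u p : R :=
  5/2 * p + 1/2 * rho * (us - u) ^+ 2 - 7/2 * K * t ^+ 2 * rho + K * t ^+ 7.

Lemma energyE U : energy U =
  5/2 * pressure U + 1/2 * density U * velocity U ^+ 2.
Proof.
rewrite /pressure /gamma; move: (energy U) (density U) (velocity U) => e r v;
  lra.
Qed.

Lemma momentumE U : 0 < density U -> momentum U = density U * velocity U.
Proof. by move=> r0; rewrite /velocity mulrC divfK// gt_eqF. Qed.

Lemma mk_stateE (a b c : R) : (density (mk_state a b c) = a) *
  (momentum (mk_state a b c) = b) * (energy (mk_state a b c) = c).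
Proof.
by rewrite /density /momentum /energy /mk_state !mxE /= !inordK.
Qed.

Lemma tangentE K t us U : 0 < density U ->
  tangent K t us U + K * t ^+ 7 =
    tangent_gap K t us (density U) (velocity U) (pressure U).
Proof.
move=> r0; rewrite /tangent momentumE// energyE /tangent_gap.
by move: (pressure U) (density U) (velocity U) => p r v; lra.
Qed.

(** [D_F] is the advection [u D] plus the work of the pressure difference against the relative
    velocity. *)
Lemma tangent_flux K t us U : 0 < density U ->
  tangent K t us (flux U) + us * (K * t ^+ 7) =
  velocity U * tangent_gap K t us (density U) (velocity U) (pressure U) +
  (pressure U - K * t ^+ 7) * (velocity U - us).
Proof.
move=> r0; rewrite /tangent /flux !mk_stateE momentumE// energyE /tangent_gap.
by move: (pressure U) (density U) (velocity U) => p r v; lra.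
Qed.

Lemma tangent_ge0 K t us U : 0 < K -> 0 <= t -> in_cone K U ->
  0 <= tangent K t us U + K * t ^+ 7.
Proof.
move=> K0 t0 /[dup] UK [s s0 [rE pK]];
  rewrite tangentE ?(in_cone_density UK)// /tangent_gap rE.
have w2 : 0 <= s ^+ 5 * (us - velocity U) ^+ 2.
  by rewrite mulr_ge0 ?sqr_ge0// exprn_ge0// ltW.
have s0' := ltW s0.
(* Homogeneous form of [rest_gapE], with [z = s / t]. *)
have : 0 <= K * ((t - s) ^+ 2 * (2 * t ^+ 5 + 4 * (t ^+ 4 * s)
    + 6 * (t ^+ 3 * s ^+ 2)
    + 8 * (t ^+ 2 * s ^+ 3) + 10 * (t * s ^+ 4) + 5 * s ^+ 5)).
  rewrite mulr_ge0 ?(ltW K0)// mulr_ge0 ?sqr_ge0// !addr_ge0// ?mulr_ge0//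
    ?exprn_ge0//;
    try exact: mulr_ge0.
move: w2 pK; move: (pressure U) (velocity U) => p v; clear; lra.
Qed.

(** One tangent suffices: at the state's own density and velocity, [D] is [5/2 (p - K t^7)]. *)
Lemma in_cone_tangent K t U : 0 < t -> density U = t ^+ 5 ->
  0 <= tangent K t (velocity U) U + K * t ^+ 7 -> in_cone K U.
Proof.
move=> t0 rE; have r0 : 0 < density U by rewrite rE exprn_gt0.
rewrite tangentE// /tangent_gap rE subrr => D0; exists t => //; split=> //.
by move: D0; move: (pressure U) => p; lra.
Qed.

(** Densities are scaled by [t^5], pressures by [K t^7] and velocities by [k]; the factor
    [7/5 K t^7 k], which is [rho* c*^3], undoes the scaling. *)
Lemma primitive_step_ge0 K t us lam s u p c s' u' p' c' :
  0 < K -> 0 < t -> `|us| <= lam ->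
  0 < s -> K * s ^+ 7 <= p -> 0 <= c -> s ^+ 5 * c ^+ 2 = 7/5 * p ->
    `|u| + c <= lam ->
  0 < s' -> K * s' ^+ 7 <= p' -> 0 <= c' -> s' ^+ 5 * c' ^+ 2 = 7/5 * p' ->
    `|u'| + c' <= lam ->
  0 <= (lam - u) * tangent_gap K t us (s ^+ 5) u p - (p - K * t ^+ 7) * (u - us)
       + lam * tangent_gap K t us (s' ^+ 5) u' p'.
Proof.
move=> K0 t0 usl s0 pK c0 cE ul s0' pK' c0' cE' ul'.
(* the sound speed of the reference state *)
pose k := Num.sqrt (7/5 * K) * t.
have k0 : 0 < k by rewrite mulr_gt0// sqrtr_gt0 mulr_gt0//; lra.
have kE : k ^+ 2 = 7/5 * K * t ^+ 2.
  by rewrite exprMn sqr_sqrtr// mulr_ge0 ?(ltW K0).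
have nondim s1 p1 c1 : 0 < s1 -> K * s1 ^+ 7 <= p1 -> 0 <= c1 ->
    s1 ^+ 5 * c1 ^+ 2 = 7/5 * p1 ->
    exists2 z, 0 <= z & [/\ p1 = K * t ^+ 7 * z ^+ 7, 0 <= (s1 / t) ^+ 5,
      (s1 / t) ^+ 5 <= z ^+ 5, z <= c1 / k &
      (s1 / t) ^+ 5 * (c1 / k) ^+ 2 = z ^+ 7].
  move=> s10 p1K c10 c1E.
  have p10 : 0 < p1 by apply: lt_le_trans p1K; rewrite mulr_gt0// exprn_gt0.
  have [z z0 zE] := root_exists 6 (divr_gt0 p10 (mulr_gt0 K0 (exprn_gt0 7 t0))).
  have p1E : p1 = K * t ^+ 7 * z ^+ 7.
    by rewrite zE mulrC divfK// gt_eqF// mulr_gt0// exprn_gt0.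
  have st0 : 0 <= s1 / t by rewrite divr_ge0// ltW.
  have rc : (s1 / t) ^+ 5 * (c1 / k) ^+ 2 = z ^+ 7.
    rewrite !expr_div_n mulrACA c1E kE p1E; field.
    by rewrite !gt_eqF.
  have stz : s1 / t <= z.
    rewrite -(@ler_pXn2r _ 7) ?nnegrE ?(ltW z0)//.
    rewrite expr_div_n ler_pdivrMr ?exprn_gt0// -(ler_pM2l K0); lra.
  exists z; first exact: ltW.
  split=> //; first exact: exprn_ge0.
    by rewrite ler_pXn2r ?nnegrE ?(ltW z0).
  rewrite -(@ler_pXn2r _ 2) ?nnegrE ?divr_ge0 ?(ltW z0) ?(ltW k0)//.
  rewrite -(@ler_pM2l _ (z ^+ 5)) ?exprn_gt0// -exprD -rc.
  by rewrite ler_wpM2r ?sqr_ge0// ler_pXn2r ?nnegrE ?(ltW z0).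
have [z z0 [pE r0 rz zc rc]] := nondim _ _ _ s0 pK c0 cE.
have [z' z0' [pE' r0' rz' zc' _]] := nondim _ _ _ s0' pK' c0' cE'.
have scale v e : `|v| + e <= lam -> `|v / k| + e / k <= lam / k.
  by rewrite normrM (gtr0_norm (_ : 0 < k^-1)) ?invr_gt0// -mulrDl ler_pM2r
    ?invr_gt0.
have usk : `|us / k| <= lam / k.
  by rewrite normrM (gtr0_norm (_ : 0 < k^-1)) ?invr_gt0// ler_pM2r ?invr_gt0.
have DE s1 u1 z1 : tangent_gap K t us (s1 ^+ 5) u1 (K * t ^+ 7 * z1 ^+ 7) =
    7/5 * K * t ^+ 7 * gap ((s1 / t) ^+ 5) (us / k - u1 / k) (z1 ^+ 7).
  rewrite /tangent_gap /gap -mulrBl expr_div_n [(_ / k) ^+ 2]expr_div_n kE;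
    field.
  by rewrite !gt_eqF.
have := gap_step_sum_ge0 usk z0 r0 rz zc rc (scale _ _ ul) z0' r0' rz' zc'
  (scale _ _ ul').
rewrite pE pE' !DE => G.
have C0 : 0 <= 7/5 * K * t ^+ 7 * k.
  by rewrite !mulr_ge0 ?exprn_ge0 ?(ltW K0) ?(ltW t0) ?(ltW k0)//; lra.
have := mulr_ge0 C0 G.
set d := gap _ _ _; set d' := gap _ _ _.
move/le_trans; apply; rewrite le_eqVlt; apply/orP; left; apply/eqP; field.
by rewrite gt_eqF.
Qed.

Lemma density_linear : linear_for *%R (@density R).
Proof. by move=> a X Y; rewrite /density !mxE. Qed.
HB.instance Definition _ := GRing.isLinear.Build R _ R *%R _ density_linear.

Lemma momentum_linear : linear_for *%R (@momentum R).
Proof. by move=> a X Y; rewrite /momentum !mxE. Qed.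
HB.instance Definition _ := GRing.isLinear.Build R _ R *%R _ momentum_linear.

Lemma sound_speed_ge0 U : 0 <= sound_speed U.
Proof. exact: sqrtr_ge0. Qed.

Lemma sound_speedE U : admissible U ->
  density U * sound_speed U ^+ 2 = 7/5 * pressure U.
Proof.
rewrite /sound_speed => -[]; move: (density U) (pressure U) => r p r0 p0.
rewrite sqr_sqrtr; last by rewrite divr_ge0 ?(ltW r0)// mulr_ge0 ?(ltW p0)//
  /gamma; lra.
by rewrite /gamma; field; rewrite gt_eqF.
Qed.

Lemma tangent_step_ge0 K t us lam X Y e : 0 < K -> 0 < t -> `|us| <= lam ->
  e = 1 \/ e = -1 -> in_cone K X -> in_cone K Y ->
  char_speed X <= lam -> char_speed Y <= lam ->
  0 <= lam * (tangent K t us X + K * t ^+ 7)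
       + e * (tangent K t us (flux X) + us * (K * t ^+ 7))
       + lam * (tangent K t us Y + K * t ^+ 7).
Proof.
move=> K0 t0 usl eE XK YK lX lY.
rewrite !tangentE ?tangent_flux ?(in_cone_density XK) ?(in_cone_density YK)//.
have [aX _] := in_cone_entropy 0 K0 XK; have [aY _] := in_cone_entropy 0 K0 YK.
move: XK YK lX lY (sound_speedE aX) (sound_speedE aY) (sound_speed_ge0 X)
  (sound_speed_ge0 Y).
rewrite /char_speed => -[s s0 [-> pX]] -[s' s0' [-> pY]].
move: (velocity X) (velocity Y) (pressure X) (pressure Y) (sound_speed X)
  (sound_speed Y) pX pY => u u' p p' c c' pX pY lX lY cE cE' c0 c0'.
case: eE => ->.
  (* Reflecting all velocities exchanges the two signs of the flux. *)
  have := @primitive_step_ge0 K t (- us) lam s (- u) p c s' (- u') p' c' K0 t0.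
  rewrite !normrN => /(_ usl s0 pX c0 cE lX s0' pY c0' cE' lY).
  by rewrite /tangent_gap; lra.
have := @primitive_step_ge0 K t us lam s u p c s' u' p' c' K0 t0.
move=> /(_ usl s0 pX c0 cE lX s0' pY c0' cE' lY).
by rewrite /tangent_gap; lra.
Qed.

(** These bounds limit the velocity of [boundary_part] by [lam]. The last one rests on
    [rho (lam^2 - u^2) >= rho c^2 >= p]. *)
Lemma step_momentum lam U e : e = 1 \/ e = -1 -> admissible U ->
    char_speed U <= lam ->
  [/\ 0 < lam * density U + e * density (flux U),
   `|momentum U| <= lam * density U &
   `|lam * momentum U + e * momentum (flux U)| <=
     lam * (lam * density U + e * density (flux U))].
Proof.
move=> eE aU lU; rewrite /flux !mk_stateE momentumE; last by case: aU.
move: (sound_speedE aU) (sound_speed_ge0 U) lU; case: aU; rewrite /char_speed.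
move: (density U) (pressure U) (velocity U) (sound_speed U) =>
  r p u c r0 p0 cE c0 ul.
have cp : 0 < c.
  rewrite lt_def c0 andbT; apply/eqP => cz; move: cE; rewrite cz expr0n mulr0;
    lra.
have u1 := ler_norm u; have u2 := ler_norm (- u); rewrite normrN in u2.
have rl : 0 < r * (lam - u - c / 2) by rewrite mulr_gt0//; lra.
have rl' : 0 < r * (lam + u - c / 2) by rewrite mulr_gt0//; lra.
have rc : 0 < r * c by rewrite mulr_gt0.
have m1 : 0 <= r * ((lam - u) * (lam + u) - c ^+ 2).
  rewrite mulr_ge0 ?(ltW r0)// subr_ge0 expr2 ler_pM//; lra.
have m2 : 0 <= r * (lam - u) ^+ 2 by rewrite mulr_ge0 ?sqr_ge0// ltW.
have m3 : 0 <= r * (lam + u) ^+ 2 by rewrite mulr_ge0 ?sqr_ge0// ltW.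
split.
- by case: eE => ->; lra.
- by rewrite ler_norml; apply/andP; split; lra.
- by rewrite ler_norml; case: eE => ->; apply/andP; split; lra.
Qed.

(** * The boundary part of the updated average *)

Definition boundary_part a lam thl thr Ul Ur Um Up : @state R :=
  thl *: Ul + thr *: Ur
  - a *: (llf_flux lam Ul Um (-1) + llf_flux lam Ur Up 1).

(** Each of the four traces enters through [lam U + F(U)] or [lam U - F(U)]; the inner traces keep
    [thl - a lam] and [thr - a lam] as surplus. *)
Lemma boundary_partE (f : {linear (@state R) -> R | *%R})
    a lam thl thr Ul Ur Um Up :
  f (boundary_part a lam thl thr Ul Ur Um Up) =
  (thl - a * lam) * f Ul + (thr - a * lam) * f Ur +
  a / 2 * ((lam * f Ul + 1 * f (flux Ul)) + (lam * f Um + 1 * f (flux Um))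
         + (lam * f Ur + (-1) * f (flux Ur)) + (lam * f Up +
           (-1) * f (flux Up))).
Proof.
rewrite /boundary_part /llf_flux !(linearB f, linearD f, linearZ_LR f) /=.
move: (f Ul) (f Ur) (f Um) (f Up) (f (flux Ul)) (f (flux Ur)) (f (flux Um))
  (f (flux Up)).
by move=> *; lra.
Qed.

(** [tangent_step_ge0] requires [|us| <= lam]. It is applied only at the density and velocity of the
    normalized state [V], which puts [V] in the set; [tangent_ge0] then gives all tangents. *)
Lemma boundary_part_tangent_ge0 K a lam thl thr Ul Ur Um Up :
  0 < K -> 0 < a -> 0 < thl -> 0 < thr ->
  a * lam <= thl / 2 -> a * lam <= thr / 2 ->
  in_cone K Ul -> in_cone K Ur -> in_cone K Um -> in_cone K Up ->
  char_speed Ul <= lam -> char_speed Ur <= lam ->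
  char_speed Um <= lam -> char_speed Up <= lam ->
  let Z := boundary_part a lam thl thr Ul Ur Um Up in
  0 < density Z /\
  forall t us, 0 <= t -> 0 <= tangent K t us Z + (thl + thr) * (K * t ^+ 7).
Proof.
move=> K0 a0 thl0 thr0 CFLl CFLr Kl Kr Km Kp ll lr lm lp Z.
have adm U (KU : in_cone K U) : admissible U by case: (in_cone_entropy 0 K0 KU).
have p1 : (1 : R) = 1 \/ (1 : R) = -1 by left.
have n1 : (-1 : R) = 1 \/ (-1 : R) = -1 by right.
have [dl ml fl] := step_momentum p1 (adm _ Kl) ll.
have [dm mm fm] := step_momentum p1 (adm _ Km) lm.
have [dr mr fr] := step_momentum n1 (adm _ Kr) lr.
have [dp mp fp] := step_momentum n1 (adm _ Kp) lp.
have cl : 0 <= thl - a * lam by clear -CFLl thl0; lra.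
have cr : 0 <= thr - a * lam by clear -CFLr thr0; lra.
have a2 : 0 < a / 2 by rewrite divr_gt0.
have rl := in_cone_density Kl; have rr := in_cone_density Kr.
have Z0 : 0 < density Z.
  rewrite boundary_partE ltr_wpDl ?addr_ge0 ?mulr_ge0 ?(ltW rl) ?(ltW rr)//.
  by rewrite mulr_gt0//; exact: addr_gt0 (addr_gt0 (addr_gt0 dl dm) dr) dp.
have lam0 : 0 <= lam.
  by apply: le_trans ll; rewrite /char_speed addr_ge0 ?sound_speed_ge0.
have Zm : `|momentum Z| <= lam * density Z.
  rewrite !boundary_partE.
  have scale c (x y : R) : 0 <= c -> `|x| <= y -> `|c * x| <= c * y.
    by move=> c0 xy; rewrite normrM ger0_norm// ler_wpM2l.
  have add (x y b c : R) : `|x| <= b -> `|y| <= c -> `|x + y| <= b + c.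
    by move=> xb yc; apply: le_trans (ler_normD _ _) _; exact: lerD.
  have := add _ _ _ _ (add _ _ _ _ (scale _ _ _ cl ml) (scale _ _ _ cr mr))
    (scale _ _ _ (ltW a2) (add _ _ _ _ (add _ _ _ _
      (add _ _ _ _ fl fm) fr) fp)).
  move/le_trans; apply; rewrite le_eqVlt; apply/orP; left; apply/eqP.
  by clear; ring.
have w0 : 0 < thl + thr by rewrite addr_gt0.
split=> // t us t0.
pose V := (thl + thr)^-1 *: Z.
have V0 : 0 < density V by rewrite linearZ /= mulr_gt0 ?invr_gt0.
have [s s0 sE] := root_exists 4 V0.
have vV : `|velocity V| <= lam.
  rewrite /velocity !linearZ /= -mulf_div divff ?mul1r ?invr_neq0 ?gt_eqF//.
  by rewrite normrM normfV (gtr0_norm Z0) ler_pdivrMr.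
have KV : in_cone K V.
  apply: (in_cone_tangent s0 (esym sE)).
  move: (velocity V) vV => v vl.
  (* Each use takes [lam D] of the inner trace on its side with weight [a / 2]; the two uses per
     side take [a lam] of the surplus, within the CFL bound. *)
  have gl := tangent_step_ge0 K0 s0 vl p1 Kl Kl ll ll.
  have gm := tangent_step_ge0 K0 s0 vl p1 Km Kl lm ll.
  have gr := tangent_step_ge0 K0 s0 vl n1 Kr Kr lr lr.
  have gp := tangent_step_ge0 K0 s0 vl n1 Kp Kr lp lr.
  have Dl := tangent_ge0 v K0 (ltW s0) Kl.
  have Dr := tangent_ge0 v K0 (ltW s0) Kr.
  rewrite linearZ /= -(pmulr_rge0 _ w0) mulrDr mulVKf ?gt_eqF//.
  rewrite boundary_partE /=.
  have := mulr_ge0 (ltW a2) (addr_ge0 (addr_ge0 gl gm) (addr_ge0 gr gp)).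
  have el : 0 <= thl - 2 * (a * lam) by clear -CFLl; lra.
  have er : 0 <= thr - 2 * (a * lam) by clear -CFLr; lra.
  have := mulr_ge0 el Dl; have := mulr_ge0 er Dr.
  move: (tangent K s v Ul) (tangent K s v Ur) (tangent K s v Um)
    (tangent K s v Up)
    (tangent K s v (flux Ul)) (tangent K s v (flux Ur))
    (tangent K s v (flux Um)) (tangent K s v (flux Up)).
  by clear=> *; lra.
have := tangent_ge0 us K0 t0 KV.
by rewrite linearZ /= -(pmulr_rge0 _ w0) mulrDr mulVKf ?gt_eqF.
Qed.

End States.

(** * Decomposition of the updated average and conclusion *)

Theorem lemma3 (R : realType) (s0 : R)
  (* element *)
  (xl xr h : R) (hx : xl < xr) (hE : h = xr - xl)
  (* DG space, quadrature rule, interpolation basis *)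
  (d Np Nq : nat) (V : {vspace {poly_d R}})
  (hNp : \dim V = Np) (hNq : (Np <= Nq)%N) (hV1 : contains_constants V)
  (x w : 'I_Nq -> R) (hquad : quadrature_exact_on V xl xr x w)
  (sigma : 'I_(\dim V) -> 'I_Nq) (phi : 'I_Nq -> {poly_d R})
  (hphi : lagrange_at_quadrature x sigma phi)
  (* DG solution and exterior traces *)
  (Ue : 'I_3 -> {poly_d R}) (Um Up : state)
  (hUV : forall i, Ue i \in V)
  (hUe : forall y, y \in `[xl, xr] -> admissible (dg_eval Ue y))
  (hUm : admissible Um) (hUp : admissible Up)
  (* time step and dissipation coefficient *)
  (dt lambda : R) (hdt : 0 < dt)
  (hlambda : Num.max (Num.max (char_speed Um) (char_speed (dg_eval Ue xl)))
                     (Num.max (char_speed (dg_eval Ue xr)) (char_speed Up))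
             <= lambda)
  (thetal thetar : R) (hthetal : 0 < thetal) (hthetar : 0 < thetar)
  (htheta : forall q, 0 <= w q - thetal * (phi q : {poly R}).[xl]
                               - thetar * (phi q : {poly R}).[xr])
  (hCFL : dt * lambda / h <= 2^-1 * Num.min thetal thetar) :
  let Unew := updated_average xl xr dt lambda Ue Um Up in
  admissible Unew /\
  exists2 se0, is_minimum (entropy_values s0 xl xr Ue Um Up) se0 &
    se0 <= entropy s0 Unew.
Proof.
move=> Unew; have [m mmin] := entropy_min_exists s0 Um Up hx hUe.
pose K : R := expR (m - s0); have K0 : 0 < K by exact: expR_gt0.
have [_ mlb] := mmin.
have Kin y : y \in `[xl, xr] -> in_cone K (dg_eval Ue y).
  by move=> yI; apply: entropy_in_cone; [exact: hUe|apply: mlb; left; exists y].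
have Km : in_cone K Um by apply: entropy_in_cone => //; apply: mlb; right; left.
have Kp : in_cone K Up by apply: entropy_in_cone => //; apply: mlb;
  right; right.
have Kl : in_cone K (dg_eval Ue xl) by apply: Kin; rewrite in_itv /= lexx ltW.
have Kr : in_cone K (dg_eval Ue xr) by apply: Kin; rewrite in_itv /= lexx ltW.
suff KU : in_cone K Unew.
  have [aU] := in_cone_entropy s0 K0 KU.
  by rewrite expRK subrK => mU; split=> //; exists m.
move: hlambda; rewrite !ge_max => /andP[/andP[lm ll] /andP[lr lp]].
have h0 : 0 < h by rewrite hE subr_gt0.
pose a := dt / h; have a0 : 0 < a by rewrite divr_gt0.
have [CFLl CFLr] : a * lambda <= thetal / 2 /\ a * lambda <= thetar / 2.
  have -> : a * lambda = dt * lambda / h by rewrite /a mulrAC.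
  by split; apply: (le_trans hCFL);
    rewrite mulrC ler_pM2r ?invr_gt0// ge_min lexx ?orbT.
pose theta q := w q - thetal * (phi q : {poly R}).[xl] - thetar *
  (phi q : {poly R}).[xr].
have [Z0 ZT] := boundary_part_tangent_ge0 K0 a0 hthetal hthetar CFLl CFLr Kl Kr
  Km Kp ll lr lm lp.
set Z := boundary_part _ _ _ _ _ _ _ _ in Z0 ZT.
have interp P y : P \in V -> (P : {poly R}).[y] =
    \sum_q (P : {poly R}).[x q] * (phi q : {poly R}).[y].
  exact: lagrange_interpolation hphi.
have theta_sum P : P \in V -> \sum_q theta q * (P : {poly R}).[x q] =
    \sum_q w q * (P : {poly R}).[x q]
    - thetal * (P : {poly R}).[xl] - thetar * (P : {poly R}).[xr].
  move=> PV; rewrite (interp P xl PV) (interp P xr PV) !mulr_sumr -!sumrB.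
  by apply: eq_bigr => q _; rewrite /theta; ring.
have theta1 : \sum_q theta q = 1 - thetal - thetar.
  have [P PV P1] := hV1.
  have Py y : (P : {poly R}).[y] = 1 by rewrite P1 hornerE.
  have sumP (c : 'I_Nq -> R) : \sum_q c q * (P : {poly R}).[x q] = \sum_q c q.
    by apply: eq_bigr => q _; rewrite Py mulr1.
  by rewrite -sumP theta_sum// sumP (quad_weight_sum hquad) !Py !mulr1.
have avgE : dg_average xl xr Ue = \sum_q theta q *: dg_eval Ue (x q)
    + (thetal *: dg_eval Ue xl + thetar *: dg_eval Ue xr).
  apply/colP => i; rewrite !mxE summxE.
  under eq_bigr do rewrite !mxE.
  by rewrite (theta_sum _ (hUV i)) (quad_exact hquad)//; ring.
have UE : Unew = \sum_q theta q *: dg_eval Ue (x q) + Z.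
  by rewrite /Unew /updated_average avgE -hE -addrA.
have Uq q : in_cone K (dg_eval Ue (x q)) by apply: Kin;
  exact: quad_point hquad q.
have U0 : 0 < density Unew.
  rewrite UE linearD linear_sum /= ltr_wpDl// sumr_ge0// => q _.
  by rewrite linearZ /= mulr_ge0 ?htheta ?(ltW (in_cone_density (Uq q))).
have [t t0 tE] := root_exists 4 U0.
apply: (in_cone_tangent t0 (esym tE)); move: (velocity Unew) => us.
(* The weights [theta q], [thetal] and [thetar] sum to 1, which distributes the constant [K t^7]. *)
have -> : tangent K t us Unew + K * t ^+ 7 =
    \sum_q theta q * (tangent K t us (dg_eval Ue (x q)) + K * t ^+ 7)
    + (tangent K t us Z + (thetal + thetar) * (K * t ^+ 7)).
  under eq_bigr do rewrite mulrDr.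
  rewrite big_split /= -mulr_suml theta1 UE linearD linear_sum /=.
  under eq_bigr do rewrite linearZ /=.
  by ring.
rewrite addr_ge0 ?ZT ?(ltW t0)// sumr_ge0// => q _.
by rewrite mulr_ge0 ?htheta// tangent_ge0// ltW.
Qed.
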